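(* Let $1<p<\infty$, let $q$ be the conjugate index of $p$, and let $\mathcal{X}$ be a finite dimensional Banach space over $\mathbb{K}$. Let $(\{f_j\}_{j=1}^n, \{\tau_j\}_{j=1}^n)$ and $(\{g_k\}_{k=1}^n, \{\omega_k\}_{k=1}^n)$ be p-orthonormal bases for $\mathcal{X}$. If $M,N\subseteq \{1, \dots, n\}$ are such that $$o(M)^\frac{1}{q}\,o(N)^\frac{1}{p}< \frac{1}{\displaystyle \max_{1\leq j,k\leq n}|g_k(\tau_j)|},$$ then for all $x \in \mathcal{X}$, $$\|x\|\leq \left(1+\frac{1}{1-o(M)^\frac{1}{q}o(N)^\frac{1}{p}\displaystyle\max_{1\leq j,k\leq n}|g_k(\tau_j)|}\right)\left[\left(\sum_{j\in M^c}|f_j(x)|^p\right)^\frac{1}{p}+\left(\sum_{k\in N^c}|g_k(x)|^p\right)^\frac{1}{p}\right].$$ In particular, if $x\in\mathcal{X}$ is supported on $M$ in the expansion using the basis $\{\tau_j\}_{j=1}^n$ and $x$ is supported on $N$ in the expansion using the basis $\{\omega_k\}_{k=1}^n$, then $x=0$.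
   Context: $\mathbb{K}$ denotes $\mathbb{R}$ or $\mathbb{C}$. The conjugate index $q$ of $p$ is defined by $\frac1p+\frac1q=1$. For a subset $S\subseteq\{1,\dots,n\}$, $o(S)$ denotes the number of elements of $S$ and $S^c=\{1,\dots,n\}\setminus S$. Definition (p-orthonormal basis, $1<p<\infty$): let $\{\tau_j\}_{j=1}^n$ be a basis for $\mathcal{X}$ and let $\{f_j\}_{j=1}^n\subseteq\mathcal{X}^*$ be the coordinate functionals associated with $\{\tau_j\}_{j=1}^n$ (so $f_j(\tau_k)=1$ if $j=k$ and $0$ otherwise). The pair $(\{f_j\}_{j=1}^n, \{\tau_j\}_{j=1}^n)$ is a p-orthonormal basis for $\mathcal{X}$ if (i) $\|f_j\|=\|\tau_j\|=1$ for all $1\leq j\leq n$; and (ii) for every $(a_j)_{j=1}^n\in\mathbb{K}^n$, $\left\|\sum_{j=1}^n a_j\tau_j\right\|=\left(\sum_{j=1}^n|a_j|^p\right)^{1/p}$. ''$x$ is supported on $M$ in the expansion using $\{\tau_j\}_{j=1}^n$'' means $f_j(x)=0$ for all $j\in M^c$; ''$x$ is supported on $N$ in the expansion using $\{\omega_k\}_{k=1}^n$'' means $g_k(x)=0$ for all $k\in N^c$. *)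

(* Defs.v *)
From HB Require Import structures.
From mathcomp Require Import all_boot all_order all_algebra.
From mathcomp Require Import all_classical all_reals all_analysis.
From mathcomp Require Import complex.

Set Implicit Arguments.
Unset Strict Implicit.
Unset Printing Implicit Defensive.

Import Order.TTheory GRing.Theory Num.Theory.
Import numFieldNormedType.Exports.

Local Open Scope classical_set_scope.
Local Open Scope ring_scope.

Variant scalar_kind := RealScalars | ComplexScalars.

Definition scalars (R : realType) (s : scalar_kind) : numFieldType :=
  match s with
  | RealScalars => R
  | ComplexScalars => R[i]
  end.

Definition scalar_re (R : realType) (s : scalar_kind) : scalars R s -> R :=
  match s with
  | RealScalars => id
  | ComplexScalars => fun z : R[i] => complex.Re z
  end.

#[short(type="finBanachType")]
HB.structure Definition FinBanach (K : numFieldType) :=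
  {X of CompleteNormedModule K X & Vector K X}.

(* The library's norm over a numFieldType K takes its values in K itself, as
   nonnegative (hence real) elements; [rnorm] is the same norm read in R. *)
Definition rnorm (R : realType) (s : scalar_kind)
    (V : normedZmodType (scalars R s)) (x : V) : R :=
  scalar_re `|x|.

(* Extended-real valued, so that an unbounded functional has norm +oo. *)
Definition dual_norm (R : realType) (s : scalar_kind)
    (X : finBanachType (scalars R s))
    (f : {linear X -> (scalars R s)^o}) : \bar R :=
  ereal_sup [set (rnorm (f x))%:E | x in [set x : X | rnorm x <= 1]].

Record p_orthonormal_basis (R : realType) (s : scalar_kind)
    (X : finBanachType (scalars R s)) (n : nat) (p : R)
    (f : 'I_n -> {linear X -> (scalars R s)^o}) (tau : n.-tuple X) : Prop := {
  pob_basis : basis_of fullv tau;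
  pob_continuous : forall j, continuous (f j);
  pob_coordinate : forall j k : 'I_n, f j tau`_k = (j == k)%:R;
  pob_norm_functional : forall j, dual_norm (f j) = 1%:E;
  pob_norm_vector : forall j : 'I_n, rnorm tau`_j = 1;
  pob_norm_expansion : forall a : 'I_n -> scalars R s,
    rnorm (\sum_j a j *: tau`_j) = (\sum_j rnorm (a j) `^ p) `^ p^-1
}.

(* The maximum over j, k; the seed 0 is harmless as the entries are >= 0. *)
Definition max_cross (R : realType) (s : scalar_kind)
    (X : finBanachType (scalars R s)) (n : nat)
    (g : 'I_n -> {linear X -> (scalars R s)^o}) (tau : n.-tuple X) : R :=
  \big[Num.max/0]_(j < n) \big[Num.max/0]_(k < n) rnorm (g k tau`_j).

Definition supported_on (R : realType) (s : scalar_kind)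
    (X : finBanachType (scalars R s)) (n : nat)
    (f : 'I_n -> {linear X -> (scalars R s)^o}) (M : {set 'I_n}) (x : X) : Prop :=
  forall j, j \in ~: M -> f j x = 0.

(* Main.v *)
(* Let P and Q be the coordinate projections onto M along tau and onto N along
   omega, and P' and Q' the complementary ones; condition (ii) makes them all
   contractions. Each coefficient g_k (P x) with k in N is at most
   max|g_k(tau_j)| times the l^1 norm of the coefficients of P x, so Hoelder's
   inequality gives |Q P x| <= t |P x|, where
   t = o(M)^(1/q) o(N)^(1/p) max|g_k(tau_j)| < 1. Hence
   |P x| <= |Q P x| + |Q'(x - P' x)| <= t |P x| + |Q' x| + |P' x|,
   and |x| <= |P x| + |P' x| concludes. *)
Require Import Defs.
From HB Require Import structures.
From mathcomp Require Import all_boot all_order all_algebra.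
From mathcomp Require Import all_classical all_reals all_analysis.
From mathcomp Require Import complex.
From mathcomp Require Import lra.

Set Implicit Arguments.
Unset Strict Implicit.
Unset Printing Implicit Defensive.

Import Order.TTheory GRing.Theory Num.Theory.
Import numFieldNormedType.Exports.

Local Open Scope ring_scope.

Lemma powRK (R : realType) (p x : R) : p != 0 -> 0 <= x -> (x `^ p^-1) `^ p = x.
Proof. by move=> p0 x0; rewrite -powRrM mulVf// powRr1. Qed.

(** Hoelder's inequality against the constant 1 on [A], whose l^q norm is the first factor. Both
    factors are normalised to 1 so that Young's inequality can be summed termwise. *)
Lemma sum_le_card_powR (R : realType) (p q : R) (I : finType) (A : {set I})
    (a : I -> R) :
  0 < p -> 0 < q -> p^-1 + q^-1 = 1 -> (forall i, 0 <= a i) ->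
  \sum_(i in A) a i <=
    #|A|%:R `^ q^-1 * (\sum_(i in A) a i `^ p) `^ p^-1.
Proof.
move=> p0 q0 pq a0; set S := _ `^ p^-1; set C := _ `^ q^-1.
have C0 : 0 <= C by exact: powR_ge0.
have S0 : 0 <= S by exact: powR_ge0.
have sum0 : 0 <= \sum_(i in A) a i `^ p.
  by apply: sumr_ge0 => i _; exact: powR_ge0.
have Sp : S `^ p = \sum_(i in A) a i `^ p by rewrite powRK// gt_eqF.
(* The cases [C = 0] (empty [A]) and [S = 0] (all terms zero on [A]) are split off, since neither
   factor can then be normalised. *)
have [A0|A0] := posnP #|A|.
  by rewrite (cards0_eq A0) big_set0 mulr_ge0.
have Cq : C `^ q = #|A|%:R by rewrite powRK ?gt_eqF.
have Cgt0 : 0 < C by apply: powR_gt0; rewrite ltr0n.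
have [S_eq0|Sneq0] := eqVneq S 0.
  rewrite S_eq0 mulr0 big1// => i iA; apply: (@powR_eq0_eq0 _ _ p).
  move: Sp; rewrite S_eq0 powR0 ?gt_eqF// => /esym/eqP.
  rewrite psumr_eq0; last by move=> *; exact: powR_ge0.
  by move=> /allP/(_ i (mem_index_enum _)); rewrite iA => /eqP.
have Sgt0 : 0 < S by rewrite lt_def Sneq0.
rewrite -[leRHS]mul1r -ler_pdivrMr ?mulr_gt0// big_distrl/=.
have powRV (x r : R) : 0 <= x -> x^-1 `^ r = (x `^ r)^-1.
  by move=> x0; rewrite -!powR_inv1 ?powR_ge0// powRAC.
(* Young's inequality applied to the normalised terms [a i / S] and [C^-1]. *)
apply: (@le_trans _ _ (\sum_(i in A) (a i `^ p / S `^ p / p + (C `^ q)^-1 / q))).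
  apply: ler_sum => i _; rewrite -(powRV _ _ S0) -(powRV _ _ C0).
  rewrite -powRM ?invr_ge0// invfM [C^-1 * _]mulrC mulrA.
  by apply: conjugate_powR; rewrite ?mulr_ge0 ?invr_ge0.
rewrite big_split/= -!big_distrl/= -Sp divff;
  last by rewrite powR_eq0 (negbTE Sneq0).
rewrite sumr_const Cq -[_^-1 *+ _]mulr_natl divff ?pnatr_eq0 -?lt0n//.
by rewrite !mul1r pq.
Qed.

(** Comparison with the constant family [B], whose l^p norm over [A] is the right-hand side. *)
Lemma powR_sum_le_card (R : realType) (p B : R) (I : finType) (A : {set I})
    (a : I -> R) :
  0 < p -> (forall i, 0 <= a i) -> 0 <= B -> (forall i, a i <= B) ->
  (\sum_(i in A) a i `^ p) `^ p^-1 <= #|A|%:R `^ p^-1 * B.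
Proof.
move=> p0 a0 B0 aB.
have -> : #|A|%:R `^ p^-1 * B = (#|A|%:R * B `^ p) `^ p^-1.
  by rewrite powRM ?powR_ge0// -powRrM mulfV ?gt_eqF// powRr1.
apply: ge0_ler_powR; rewrite ?nnegrE ?invr_ge0 ?(ltW p0)//.
- by apply: sumr_ge0 => i _; exact: powR_ge0.
- by rewrite mulr_ge0 ?powR_ge0.
rewrite mulr_natl -sumr_const; apply: ler_sum => i _.
by apply: ge0_ler_powR; rewrite ?nnegrE ?(ltW p0).
Qed.

Section ScalarNorm.
Context (R : realType) (s : scalar_kind).
Local Notation K := (scalars R s).

Lemma scalar_reD (a b : K) : scalar_re (a + b) = scalar_re a + scalar_re b.
Proof. by case: s a b => //= -[a b] [c d]. Qed.

(** Over the complex numbers, [a <= b] means equal imaginary parts and ordered real parts. *)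
Lemma ler_scalar_re (a b : K) : a <= b -> scalar_re a <= scalar_re b.
Proof. by case: s a b => //= a b; rewrite complex.lecE => /andP[]. Qed.

Lemma scalar_re0 : scalar_re (0 : K) = 0.
Proof. by case: s. Qed.

(** Real parts are not multiplicative in general, but a norm has zero imaginary part. *)
Lemma scalar_re_normM (a b : K) :
  scalar_re (`|a| * `|b|) = scalar_re `|a| * scalar_re `|b|.
Proof. by case: s a b => //= -[a b] [c d] /=; rewrite !mul0r subr0. Qed.

Lemma scalar_re_norm_eq0 (a : K) : 0 <= a -> scalar_re a = 0 -> a = 0.
Proof.
case: s a => //= -[a b]; rewrite complex.lecE/= => /andP[/eqP-> _] ->.
by [].
Qed.

Section Rnorm.
Context (V : normedZmodType K).
Implicit Types x y : V.

Lemma rnorm_ge0 x : 0 <= rnorm x.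
Proof. by rewrite -scalar_re0; apply: ler_scalar_re. Qed.

Lemma ler_rnormD x y : rnorm (x + y) <= rnorm x + rnorm y.
Proof. by rewrite -scalar_reD; apply/ler_scalar_re/ler_normD. Qed.

Lemma rnorm0 : rnorm (0 : V) = 0.
Proof. by rewrite /rnorm normr0 scalar_re0. Qed.

Lemma rnorm_eq0 x : rnorm x = 0 -> x = 0.
Proof. by move=> /scalar_re_norm_eq0-/(_ (normr_ge0 _))/normr0_eq0. Qed.

Lemma ler_rnorm_sum (I : Type) (r : seq I) (P : pred I) (F : I -> V) :
  rnorm (\sum_(i <- r | P i) F i) <= \sum_(i <- r | P i) rnorm (F i).
Proof.
elim/big_ind2 : _ => [|x a y b xa yb|//]; first by rewrite rnorm0.
by apply: le_trans (ler_rnormD _ _) _; exact: lerD.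
Qed.

End Rnorm.

Lemma rnormM (a b : K) : rnorm (a * b) = rnorm a * rnorm b.
Proof. by rewrite /rnorm normrM scalar_re_normM. Qed.

End ScalarNorm.

Section Expansion.
Context (R : realType) (s : scalar_kind) (X : finBanachType (scalars R s)).
Context (n : nat) (p : R).

(** For a basis [tau] with coordinate functionals [f], the coordinate projection onto the span of
    the vectors indexed by [S]. *)
Definition partial_expansion (f : 'I_n -> {linear X -> (scalars R s)^o})
    (tau : n.-tuple X) (S : {set 'I_n}) (x : X) : X :=
  \sum_(j in S) (f j x : scalars R s) *: tau`_j.

Context (f : 'I_n -> {linear X -> (scalars R s)^o}) (tau : n.-tuple X).
Context (p_gt0 : 0 < p) (ftau : p_orthonormal_basis p f tau).
Local Notation P := (partial_expansion f tau).

Lemma partial_expansionD S x y : P S (x + y) = P S x + P S y.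
Proof.
by rewrite -big_split/=; apply: eq_bigr => j _; rewrite linearD scalerDl.
Qed.

Lemma partial_expansionC S x : P S x + P (~: S) x = x.
Proof.
have -> : P S x + P (~: S) x = \sum_j (f j x : scalars R s) *: tau`_j.
  rewrite [RHS](bigID (mem S))/=; congr (_ + _).
  by apply: eq_bigl => j; rewrite inE.
have /coord_span xE : x \in <<tau>>%VS.
  by rewrite (span_basis (pob_basis ftau)) memvf.
rewrite {2}xE; apply: eq_bigr => j _; congr (_ *: _).
(* Biorthogonality keeps only the term of index [j], so [f j] agrees with the library's [coord]. *)
rewrite {1}xE linear_sum (bigD1 j)//= big1 ?addr0 => [|i ij].
  by rewrite linearZ/= (pob_coordinate ftau) eqxx; exact: mulr1.
by rewrite linearZ/= (pob_coordinate ftau) eq_sym (negbTE ij); exact: mulr0.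
Qed.

Lemma rnorm_partial_expansion S x :
  rnorm (P S x) = (\sum_(j in S) rnorm (f j x) `^ p) `^ p^-1.
Proof.
have := pob_norm_expansion ftau
  (fun j => if j \in S then f j x : scalars R s else 0).
rewrite [P S x]big_mkcond/= => H.
transitivity
  (rnorm (\sum_j (if j \in S then f j x : scalars R s else 0) *: tau`_j)).
  by congr (rnorm _); apply: eq_bigr => j _; case: ifP => // _; rewrite scale0r.
rewrite H; congr (_ `^ _); rewrite [RHS]big_mkcond; apply: eq_bigr => j _; case: ifP => // _.
by rewrite rnorm0 powR0// gt_eqF.
Qed.

(** Since [x] is its own expansion over all indices, passing to [S] only drops nonnegative terms
    from the sum of p-th powers. *)
Lemma rnorm_partial_expansion_le S x : rnorm (P S x) <= rnorm x.
Proof.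
have xE : P [set: 'I_n]%SET x = x.
  rewrite -[RHS](partial_expansionC [set: 'I_n]%SET) finset.setCT.
  by rewrite [P finset.set0 x]big_set0 addr0.
rewrite -[in leRHS]xE !rnorm_partial_expansion.
have sum0 T : 0 <= \sum_(j in T) rnorm (f j x) `^ p.
  by apply: sumr_ge0 => j _; exact: powR_ge0.
apply: ge0_ler_powR; rewrite ?nnegrE ?invr_ge0 ?(ltW p_gt0)//.
rewrite [leRHS](big_setID S)/= finset.setTI lerDl sumr_ge0// => j _.
exact: powR_ge0.
Qed.

End Expansion.

Lemma le_max_cross (R : realType) (s : scalar_kind)
    (X : finBanachType (scalars R s)) (n : nat)
    (g : 'I_n -> {linear X -> (scalars R s)^o}) (tau : n.-tuple X)
    (j k : 'I_n) :
  rnorm (g k tau`_j) <= max_cross g tau.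
Proof.
apply: (bigmax_sup j) => //.
exact: (le_bigmax _ (fun k => rnorm (g k tau`_j))).
Qed.

Lemma max_cross_ge0 (R : realType) (s : scalar_kind)
    (X : finBanachType (scalars R s)) (n : nat)
    (g : 'I_n -> {linear X -> (scalars R s)^o}) (tau : n.-tuple X) :
  0 <= max_cross g tau.
Proof. exact: bigmax_ge_id. Qed.

Lemma rnorm_partial_expansion_comp (R : realType) (s : scalar_kind) (p q : R)
    (X : finBanachType (scalars R s)) (n : nat)
    (f : 'I_n -> {linear X -> (scalars R s)^o}) (tau : n.-tuple X)
    (g : 'I_n -> {linear X -> (scalars R s)^o}) (omega : n.-tuple X)
    (M N : {set 'I_n}) (x : X) :
  0 < p -> 0 < q -> p^-1 + q^-1 = 1 ->
  p_orthonormal_basis p f tau -> p_orthonormal_basis p g omega ->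
  rnorm (partial_expansion g omega N (partial_expansion f tau M x)) <=
    #|M|%:R `^ q^-1 * #|N|%:R `^ p^-1 * max_cross g tau *
    rnorm (partial_expansion f tau M x).
Proof.
move=> p0 q0 pq ftau gomega; set c := max_cross g tau.
set y := partial_expansion f tau M x.
have c0 : 0 <= c by exact: max_cross_ge0.
rewrite (rnorm_partial_expansion p0 gomega).
(* The factor of [N] comes from a bound on the coefficients that is uniform in [k]; the rest of the
   product is that bound. *)
rewrite [_ * #|N|%:R `^ _]mulrC -!mulrA; apply: powR_sum_le_card => //.
- by move=> k; exact: rnorm_ge0.
- by rewrite !mulr_ge0 ?powR_ge0 ?rnorm_ge0.
move=> k; rewrite mulrCA linear_sum.
apply: le_trans (ler_rnorm_sum _ _ _) _.
apply: (@le_trans _ _ (\sum_(j in M) c * rnorm (f j x))).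
  apply: ler_sum => j _; rewrite linearZ/= rnormM mulrC ler_wpM2r ?rnorm_ge0//.
  exact: le_max_cross.
(* With [c] cancelled, Hoelder's inequality compares the l^1 norm of the coefficients over [M] with
   their l^p norm, which is the norm of [y]. *)
rewrite -big_distrr/= ler_wpM2l// /y (rnorm_partial_expansion p0 ftau).
by apply: sum_le_card_powR => // j; exact: rnorm_ge0.
Qed.

Theorem theorem2p5 (R : realType) (s : scalar_kind) (p q : R)
    (X : finBanachType (scalars R s)) (n : nat)
    (f : 'I_n -> {linear X -> (scalars R s)^o}) (tau : n.-tuple X)
    (g : 'I_n -> {linear X -> (scalars R s)^o}) (omega : n.-tuple X)
    (M N : {set 'I_n}) :
  1 < p -> p^-1 + q^-1 = 1 ->
  p_orthonormal_basis p f tau ->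
  p_orthonormal_basis p g omega ->
  #|M|%:R `^ q^-1 * #|N|%:R `^ p^-1 < 1 / max_cross g tau ->
  (forall x : X,
     rnorm x <=
       (1 + 1 / (1 - #|M|%:R `^ q^-1 * #|N|%:R `^ p^-1 * max_cross g tau)) *
       ((\sum_(j in ~: M) rnorm (f j x) `^ p) `^ p^-1 +
        (\sum_(k in ~: N) rnorm (g k x) `^ p) `^ p^-1)) /\
  (forall x : X, supported_on f M x -> supported_on g N x -> x = 0).
Proof.
move=> p1 pq ftau gomega; set t := _ * _; set c := max_cross g tau => tc.
have p0 : 0 < p by exact: lt_trans p1.
have q0 : 0 < q.
  by rewrite -invr_gt0 -(ltrD2l p^-1) addr0 pq invf_lt1.
have t0 : 0 <= t by rewrite mulr_ge0 ?powR_ge0.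
(* As [1 / 0 = 0] here, [0 <= t < 1 / c] excludes [c = 0]. *)
have c_gt0 : 0 < c.
  by move: (le_lt_trans t0 tc); rewrite mul1r invr_gt0.
have tc1 : 0 < 1 - t * c by rewrite subr_gt0 -ltr_pdivlMr.
have bound x : rnorm x <= (1 + 1 / (1 - t * c)) *
    ((\sum_(j in ~: M) rnorm (f j x) `^ p) `^ p^-1 +
     (\sum_(k in ~: N) rnorm (g k x) `^ p) `^ p^-1).
  pose P := partial_expansion f tau; pose Q := partial_expansion g omega.
  rewrite -(rnorm_partial_expansion p0 ftau) -/P.
  rewrite -(rnorm_partial_expansion p0 gomega) -/Q.
  have x_le : rnorm x <= rnorm (P M x) + rnorm (P (~: M) x).
    by rewrite -[in leLHS](partial_expansionC ftau M x) ler_rnormD.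
  have PMx_le : rnorm (P M x) <=
      rnorm (Q N (P M x)) + rnorm (Q (~: N) (P M x)).
    by rewrite -[in leLHS](partial_expansionC gomega N (P M x)) ler_rnormD.
  have QPMx_le : rnorm (Q (~: N) (P M x)) <=
      rnorm (Q (~: N) x) + rnorm (P (~: M) x).
    (* Substituting [P M x = x - P (~: M) x] leaves only tails, and the projection [Q (~: N)] does
       not increase the norm of the second one. *)
    have -> : Q (~: N) (P M x) = Q (~: N) x + Q (~: N) (- P (~: M) x).
      rewrite -[RHS]partial_expansionD; congr (Q _ _); apply/eqP.
      by rewrite eq_sym subr_eq (partial_expansionC ftau).
    apply: le_trans (ler_rnormD _ _) _; rewrite lerD2l.
    rewrite (le_trans (rnorm_partial_expansion_le p0 gomega _ _))//.
    by rewrite /rnorm normrN.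
  have := rnorm_partial_expansion_comp M N x p0 q0 pq ftau gomega.
  rewrite -/t -/c -/P -/Q => QNPMx_le.
  (* The term [t * c * rnorm (P M x)] is absorbed into the left-hand side. *)
  have : rnorm (P M x) <= (rnorm (P (~: M) x) + rnorm (Q (~: N) x)) / (1 - t * c).
    by rewrite ler_pdivlMr//; lra.
  (* Adding the tail [rnorm (P (~: M) x)] bounds [rnorm x]; the nonnegative tail along [omega] is
     then added to reach the symmetric form. *)
  have := rnorm_ge0 (Q (~: N) x); lra.
(* The support conditions make both tail sums vanish, so the bound reads [rnorm x <= 0]. *)
split=> // x fx gx; apply: rnorm_eq0; apply/eqP.
rewrite eq_le rnorm_ge0 andbT (le_trans (bound x))//.
rewrite !big1 ?powR0 ?addr0 ?mulr0 ?invr_eq0 ?gt_eqF// => j.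
  by move=> /gx ->; rewrite rnorm0 powR0 ?gt_eqF.
by move=> /fx ->; rewrite rnorm0 powR0 ?gt_eqF.
Qed.
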